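(* Let $(M,A,g,F,\eta,\xi)$ be an almost paracontact metric manifold with fundamental 2-form $F$, considered as a generalized Riemannian manifold $(M,G=g+F)$. Then there is a linear connection $\nabla$ on $(M,G)$ satisfying the Einstein metricity condition with totally skew-symmetric torsion $T$ if and only if $$(\nabla^g_XF)(Y,Z)=g((\nabla^g_XA)Y,Z)=\tfrac13dF(X,Y,Z)+\tfrac13dF(X,AY,AZ)-\tfrac16dF(AX,Y,AZ)-\tfrac16dF(AX,AY,Z).$$ The skew-symmetric torsion is determined by $T(X,Y,Z)=-\frac13dF(X,Y,Z)$; the connection is unique and given by $$g(\nabla_XY,Z)=g(\nabla^g_XY,Z)-\tfrac16dF(X,Y,Z)-\tfrac16dF(X,AY,Z)+\tfrac16dF(AX,Y,Z).$$ The covariant derivatives of $g$ and $F$ are determined by $$(\nabla_Xg)(Y,Z)=-\tfrac16\big[dF(X,Y,AZ)-dF(X,AY,Z)\big],\qquad (\nabla_XF)(Y,Z)=\tfrac16\big[2dF(X,Y,Z)-dF(X,Y,AZ)-dF(X,AY,Z)\big].$$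
   Context: An almost paracontact metric manifold $(M^{2n+1},g,A,\eta,\xi)$ is a $(2n+1)$-dimensional pseudo-Riemannian manifold of signature $(n+1,n)$ with a 1-form $\eta$, a $(1,1)$-tensor $A$ and a vector field $\xi$ dual to $\eta$, such that $\eta(\xi)=1$, $\eta(X)=g(X,\xi)$, $A^2=\mathrm{id}-\eta\otimes\xi$, $g(AX,AY)=-g(X,Y)+\eta(X)\eta(Y)$, $A\xi=0$; its fundamental 2-form is $F(X,Y)=g(AX,Y)$. Let $\nabla^g$ be the Levi-Civita connection of $g$. The torsion of $\nabla$ is $T(X,Y)=\nabla_XY-\nabla_YX-[X,Y]$, with $T(X,Y,Z)=g(T(X,Y),Z)$; it is totally skew-symmetric if $T(X,Y,Z)=-T(X,Z,Y)$. A linear connection $\nabla$ satisfies the Einstein metricity condition if $XG(Y,Z)-G(\nabla_YX,Z)-G(Y,\nabla_XZ)=0$ for commuting vector fields $X,Y,Z$, equivalently $(\nabla_XG)(Y,Z)=-G(T(X,Y),Z)$. The exterior derivative is normalized so that for commuting vector fields $dF(X,Y,Z)=XF(Y,Z)+YF(Z,X)+ZF(X,Y)$. Tensor identities hold for all vector fields $X,Y,Z$. *)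

(* Defs.v *)
From HB Require Import structures.
From mathcomp Require Import all_boot all_order all_algebra.
From mathcomp Require Import all_classical all_reals all_analysis.
From mathcomp Require Import ring.

Set Implicit Arguments.
Unset Strict Implicit.
Unset Printing Implicit Defensive.

Import Order.TTheory GRing.Theory Num.Theory.
Import numFieldNormedType.Exports.

Local Open Scope classical_set_scope.
Local Open Scope ring_scope.

Section SmoothOn.
Context {R : realType} {V W : normedModType R}.

(** [Ck_on k U f] is meant for open [U]: differentiability and ['D_v f] at a
    point of [U] then depend only on the restriction of [f] to [U]. *)
Fixpoint Ck_on (k : nat) (U : set V) (f : V -> W) : Prop :=
  match k with
  | 0 => forall x, U x -> {for x, continuous f}
  | k'.+1 => (forall x, U x -> differentiable f x) /\
             (forall v, Ck_on k' U ('D_v f))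
  end.

Definition smooth_on (U : set V) (f : V -> W) : Prop := forall k, Ck_on k U f.

Lemma near_differentiable (f g : V -> W) x :
  {near x, f =1 g} -> differentiable f x -> differentiable g x.
Proof.
move=> fg df; have gfx : g x = f x by rewrite (nbhs_singleton fg).
have H : g \o shift x = cst (g x) + 'd f x +o_ 0 id.
  apply/eqaddoP => e e0.
  have /eqaddoP /(_ e e0) := diff_locally df.
  have fg0 : \forall h \near (0 : V), f (h + x) = g (h + x).
    by move: fg; rewrite {1}(near_shift (0:V)) subr0.
  apply: filter_app; apply: filterS fg0 => h fgh.
  by rewrite !fctE /= -fgh gfx.
apply/diff_locallyP.
by rewrite (diff_unique (diff_continuous df) H); split=> //; exact: diff_continuous.
Qed.

Lemma Ck_on_ext k (U : set V) (f g : V -> W) : open U ->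
  (forall x, U x -> f x = g x) -> Ck_on k U f -> Ck_on k U g.
Proof.
move=> oU; elim: k f g => [|k IH] f g fg /=.
  move=> fC x Ux; have nfg : {near x, f =1 g}.
    by apply: filterS (open_nbhs_nbhs (conj oU Ux)) => y; exact: fg.
  have := fC x Ux; rewrite /prop_for /continuous_at (fg x Ux).
  by apply: cvg_trans; exact: near_eq_cvg.
have nfg x : U x -> {near x, f =1 g}.
  by move=> Ux; apply: filterS (open_nbhs_nbhs (conj oU Ux)) => y; exact: fg.
move=> [df Df]; split.
  by move=> x Ux; apply: near_differentiable (df x Ux); exact: nfg.
move=> v; apply: IH (Df v) => x Ux; apply: near_eq_derive; exact: nfg.
Qed.

Lemma Ck_onW k (U : set V) (f : V -> W) : Ck_on k.+1 U f -> Ck_on k U f.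
Proof.
elim: k f => [|k IH] f [df Df] /=.
  by move=> x Ux; exact/differentiable_continuous/df.
by split=> // v; exact/IH/Df.
Qed.

Lemma Ck_on_cst k (U : set V) (c : W) : Ck_on k U (cst c).
Proof.
elim: k c => [|k IH] c /=; first by move=> x _; exact: cvg_cst.
split=> [x _|v]; first exact: differentiable_cst.
have -> : 'D_v (cst c) = cst (0 : W); last exact: IH.
by apply/funext => x; exact: derive_cst.
Qed.

Lemma Ck_onB k (U : set V) (f g : V -> W) : open U ->
  Ck_on k U f -> Ck_on k U g -> Ck_on k U (f - g).
Proof.
move=> oU; elim: k f g => [|k IH] f g /=.
  by move=> fC gC x Ux; apply: continuousB; [exact: fC|exact: gC].
move=> [df Df] [dg Dg]; split=> [x Ux|v].
  by apply: differentiableB; [exact: df|exact: dg].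
apply: (Ck_on_ext oU) (IH _ _ (Df v) (Dg v)) => x Ux.
by rewrite deriveB //; apply: diff_derivable; [exact: df|exact: dg].
Qed.

Lemma Ck_onD k (U : set V) (f g : V -> W) : open U ->
  Ck_on k U f -> Ck_on k U g -> Ck_on k U (f + g).
Proof.
move=> oU fC gC; rewrite -[g]opprK -[- g]sub0r.
by do 2!apply: Ck_onB => //; exact: Ck_on_cst.
Qed.

End SmoothOn.

Lemma Ck_onM (R : realType) (V : normedModType R) k (U : set V) (f g : V -> R) :
  open U -> Ck_on k U f -> Ck_on k U g -> Ck_on k U (f * g).
Proof.
move=> oU; elim: k f g => [|k IH] f g.
  by move=> fC gC x Ux; apply: continuousM; [exact: fC|exact: gC].
move=> fC gC; have [df Df] := fC; have [dg Dg] := gC; split=> [x Ux|v].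
  by apply: differentiableM; [exact: df|exact: dg].
have DM : Ck_on k U (f * 'D_v g + g * 'D_v f).
  by apply: Ck_onD => //; apply: IH; by [exact: Ck_onW | exact: Df | exact: Dg].
apply: (Ck_on_ext oU) DM => x Ux.
by rewrite deriveM //; apply: diff_derivable; [exact: df|exact: dg].
Qed.

(** The two maps of a chart are total; only their values on [chart_dom] and
    [chart_img] matter. *)
Record chart (R : realType) (m : nat) (M : topologicalType) := Chart {
  chart_dom : set M ;
  chart_map : M -> 'rV[R]_m ;
  chart_inv : 'rV[R]_m -> M ;
  chart_img := chart_map @` chart_dom ;
  chart_dom_open : open chart_dom ;
  chart_img_open : open chart_img ;
  chart_mapK : {in chart_dom, cancel chart_map chart_inv} ;
  chart_map_continuous :
    forall p, chart_dom p -> {for p, continuous chart_map} ;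
  chart_inv_continuous :
    forall x, chart_img x -> {for x, continuous chart_inv} }.

Record manifold (R : realType) (m : nat) := Manifold {
  manifold_space :> topologicalType ;
  manifold_hausdorff : hausdorff_space manifold_space ;
  manifold_second_countable : @second_countable manifold_space ;
  atlas : set (chart R m manifold_space) ;
  atlas_cover : forall p, exists2 c, atlas c & chart_dom c p ;
  atlas_compatible : forall c d, atlas c -> atlas d ->
    smooth_on (chart_map c @` (chart_dom c `&` chart_dom d))
              (chart_map d \o chart_inv c) }.

Section SmoothFunctions.
Context {R : realType} {m : nat} (M : manifold R m).

Definition smooth_pred : {pred M -> R} := fun f =>
  `[< forall c, atlas c -> smooth_on (chart_img c) (f \o chart_inv c) >].

Record smooth_fun := SmoothFun {
  smooth_val :> M -> R ;
  _ : smooth_val \in smooth_pred }.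

HB.instance Definition _ := [isSub for smooth_val].
HB.instance Definition _ := [Choice of smooth_fun by <:].

Lemma smooth_subring_closed : subring_closed smooth_pred.
Proof.
split.
- apply/asboolP => c _ k; exact: (Ck_on_cst _ _ (1 : R)).
- move=> f g /asboolP fS /asboolP gS; apply/asboolP => c cA k.
  by apply: Ck_onB; [exact: chart_img_open|exact: fS|exact: gS].
- move=> f g /asboolP fS /asboolP gS; apply/asboolP => c cA k.
  by apply: Ck_onM; [exact: chart_img_open|exact: fS|exact: gS].
Qed.

Lemma smooth_scale_closed : GRing.scaler_closed smooth_pred.
Proof.
move=> a f /asboolP fS; apply/asboolP => c cA k.
exact: Ck_onM (@chart_img_open _ _ _ c) (Ck_on_cst k _ (a : R)) (fS c cA k).
Qed.

HB.instance Definition _ :=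
  GRing.isSubringClosed.Build (M -> R) smooth_pred smooth_subring_closed.
HB.instance Definition _ :=
  GRing.isScaleClosed.Build R (M -> R) smooth_pred smooth_scale_closed.
HB.instance Definition _ := GRing.SubChoice_isSubComPzRing.Build
  (M -> R) smooth_pred smooth_fun smooth_subring_closed.
HB.instance Definition _ := [SubZmodule_isSubLmodule of smooth_fun by <:].

End SmoothFunctions.

Section VectorFields.
Context {R : realType} {m : nat} (M : manifold R m).
Local Notation CM := (smooth_fun M).

(** Smooth vector fields are identified with the derivations of the algebra of
    smooth functions; they form a module over that algebra. *)
Definition is_derivation (D : CM -> CM) : Prop :=
  (forall (a : R) f h, D (a *: f + h) = a *: D f + D h) /\
  (forall f h, D (f * h) = D f * h + f * D h).

Definition derivation_pred : {pred CM -> CM^o} :=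
  fun D => `[< is_derivation D >].

Record vector_field := VectorField {
  vf_val :> CM -> CM^o ;
  _ : vf_val \in derivation_pred }.

HB.instance Definition _ := [isSub for vf_val].
HB.instance Definition _ := [Choice of vector_field by <:].

Lemma smooth_scalerAr (a : R) (f h : CM) : f * (a *: h) = a *: (f * h).
Proof. by apply/val_inj/funext => x; exact: mulrCA. Qed.

Lemma derivation_submod_closed : submod_closed derivation_pred.
Proof.
split.
- apply/asboolP.
  have D0 f : (0 : CM -> CM^o) f = 0 by [].
  split=> [a f h|f h]; rewrite !D0.
    by rewrite scaler0 addr0.
  by rewrite mul0r mulr0 addr0.
- move=> u D E /asboolP[Dl DM] /asboolP[El EM]; apply/asboolP.
  have DE f : (u *: D + E) f = u * D f + E f by [].
  split=> [a f h|f h]; rewrite !DE.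
    by rewrite Dl El mulrDr scalerDr smooth_scalerAr addrACA.
  by rewrite DM EM !mulrDr !mulrDl !mulrA (mulrC f u) addrACA.
Qed.

HB.instance Definition _ :=
  GRing.isSubmodClosed.Build CM (CM -> CM^o) derivation_pred
    derivation_submod_closed.
HB.instance Definition _ := [SubChoice_isSubLmodule of vector_field by <:].

Definition bracket_fun (X Y : vector_field) : CM -> CM^o :=
  fun f => (X (Y f) : CM) - Y (X f).

Lemma bracket_subproof (X Y : vector_field) :
  bracket_fun X Y \in derivation_pred.
Proof.
have [/asboolP[Xl XM] /asboolP[Yl YM]] := (valP X, valP Y).
apply/asboolP; split=> [a f h|f h]; rewrite /bracket_fun.
  by rewrite Yl Xl Xl Yl scalerBr opprD addrACA.
rewrite YM XM.
have XD p q : X (p + q) = X p + X q by have := Xl 1 p q; rewrite !scale1r.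
have YD p q : Y (p + q) = Y p + Y q by have := Yl 1 p q; rewrite !scale1r.
rewrite XD YD !XM !YM.
have ringE (C : comPzRingType) (f0 xf yf xyf yxf h0 xh yh xyh yxh : C) :
  xyf * h0 + yf * xh + (xf * yh + f0 * xyh) -
  (yxf * h0 + xf * yh + (yf * xh + f0 * yxh)) =
  (xyf - yxf) * h0 + f0 * (xyh - yxh) by ring.
exact: ringE.
Qed.

Definition bracket (X Y : vector_field) : vector_field :=
  VectorField (bracket_subproof X Y).

End VectorFields.

Notation "[[ X , Y ]]" := (bracket X Y) (at level 0, format "[[ X ,  Y ]]").

(** Smooth tensor fields are identified with the maps on vector fields that are
    multilinear over the algebra of smooth functions. *)

Section Tensors.
Context {R : realType} {m : nat} {M : manifold R m}.
Local Notation CM := (smooth_fun M).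
Local Notation XM := (vector_field M).

Definition is_bilinear_form (g : XM -> XM -> CM) : Prop :=
  (forall X, scalar (g X)) /\ (forall Y, scalar (g ^~ Y)).

Definition is_tangent_vector (p : M) (v : CM -> R) : Prop :=
  scalar v /\ (forall f h, v (f * h) = v f * h p + f p * v h).

Definition is_tangent_basis (p : M) k (E : 'I_k -> XM) : Prop :=
  forall v, is_tangent_vector p v ->
    exists! c : 'rV[R]_k, forall f, v f = \sum_i c ord0 i * E i f p.

(** [g X Y p] depends only on the values of [X] and [Y] at [p], and every basis
    of the tangent space at [p] extends to vector fields on [M]: the condition
    below says that the form induced by [g] at [p] has signature [(r, s)]. *)
Definition has_signature (g : XM -> XM -> CM) (r s : nat) : Prop :=
  forall p : M, exists E : 'I_(r + s) -> XM,
    is_tangent_basis p E /\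
    forall i j, g (E i) (E j) p =
      if i == j then (if (i < r)%N then 1 else -1) else 0.

Definition is_pseudo_riemannian (g : XM -> XM -> CM) (r s : nat) : Prop :=
  [/\ is_bilinear_form g, forall X Y, g X Y = g Y X & has_signature g r s].

Record connection := Connection {
  cov :> XM -> XM -> XM ;
  cov_linear : forall Y, linear (cov ^~ Y) ;
  cov_additive : forall X Y Z, cov X (Y + Z) = cov X Y + cov X Z ;
  cov_leibniz : forall X (f : CM) Y, cov X (f *: Y) = X f *: Y + f *: cov X Y }.

(** [cov_form nabla B X Y Z] is [(nabla_X B)(Y, Z)] and [cov_endo nabla A X Y]
    is [(nabla_X A) Y]. *)
Definition cov_form (nabla : connection) (B : XM -> XM -> CM)
  (X Y Z : XM) : CM :=
  X (B Y Z) - B (nabla X Y) Z - B Y (nabla X Z).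

Definition cov_endo (nabla : connection) (A : XM -> XM)
  (X Y : XM) : XM :=
  nabla X (A Y) - A (nabla X Y).

Definition torsion (nabla : connection) (X Y : XM) : XM :=
  nabla X Y - nabla Y X - [[X, Y]].

Definition has_skew_torsion (g : XM -> XM -> CM) (nabla : connection) : Prop :=
  forall X Y Z, g (torsion nabla X Y) Z = - g (torsion nabla X Z) Y.

Definition is_levi_civita (g : XM -> XM -> CM) (nabla : connection) : Prop :=
  (forall X Y, torsion nabla X Y = 0) /\
  (forall X Y Z, cov_form nabla g X Y Z = 0).

(** The condition [X G(Y,Z) - G(nabla_Y X,Z) - G(Y,nabla_X Z) = 0] on commuting
    vector fields, in its tensorial form, valid for all vector fields. *)
Definition einstein_metricity (G : XM -> XM -> CM) (nabla : connection) : Prop :=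
  forall X Y Z, cov_form nabla G X Y Z = - G (torsion nabla X Y) Z.

Lemma einstein_metricity_commuting G nabla : einstein_metricity G nabla ->
  is_bilinear_form G -> forall X Y Z, [[X, Y]] = 0 ->
  X (G Y Z) - G (nabla Y X) Z - G Y (nabla X Z) = 0.
Proof.
move=> EG [_ Gl] X Y Z XY0; have := EG X Y Z.
rewrite /cov_form /torsion XY0 subr0.
have -> : nabla X Y - nabla Y X = -1 *: nabla Y X + nabla X Y.
  by rewrite scaleN1r addrC.
rewrite Gl.
have ringE (C : comPzRingType) (a b c d : C) :
  a - b - c = - (-1 * d + b) -> a - d - c = 0.
  by move=> /eqP; rewrite -subr_eq0 => /eqP <-; ring.
exact: ringE.
Qed.

(** Invariant formula, in the normalization without the factor [1/3]. *)
Definition ext_deriv (F : XM -> XM -> CM) (X Y Z : XM) : CM :=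
  X (F Y Z) + Y (F Z X) + Z (F X Y)
  - F [[X, Y]] Z - F [[Y, Z]] X - F [[Z, X]] Y.

Lemma ext_deriv_commuting F X Y Z : is_bilinear_form F ->
  [[X, Y]] = 0 -> [[Y, Z]] = 0 -> [[Z, X]] = 0 ->
  ext_deriv F X Y Z = X (F Y Z) + Y (F Z X) + Z (F X Y).
Proof.
move=> [_ Fl] XY YZ ZX; rewrite /ext_deriv XY YZ ZX.
have F0 W : F 0 W = 0.
  by have := Fl W (-1) 0 0; rewrite scaler0 addr0 mulN1r addNr.
by rewrite !F0 !subr0.
Qed.

End Tensors.

Arguments connection {R m} M.

Section AlmostParacontact.
Context {R : realType} {n : nat}.

Record almost_paracontact_metric (M : manifold R n.*2.+1) :=
  AlmostParacontactMetric {
  apc_metric : vector_field M -> vector_field M -> smooth_fun M ;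
  apc_endo : {linear vector_field M -> vector_field M} ;
  apc_form : {scalar vector_field M} ;
  apc_field : vector_field M ;
  apc_metricP : is_pseudo_riemannian apc_metric n.+1 n ;
  apc_form_field : apc_form apc_field = 1 ;
  apc_formE : forall X, apc_form X = apc_metric X apc_field ;
  apc_endo2 : forall X,
    apc_endo (apc_endo X) = X - apc_form X *: apc_field ;
  apc_compatible : forall X Y, apc_metric (apc_endo X) (apc_endo Y) =
    - apc_metric X Y + apc_form X * apc_form Y ;
  apc_endo_field : apc_endo apc_field = 0 }.

Definition fundamental_form (M : manifold R n.*2.+1)
  (S : almost_paracontact_metric M) (X Y : vector_field M) : smooth_fun M :=
  apc_metric S (apc_endo S X) Y.

End AlmostParacontact.

(* Main.v *)
From HB Require Import structures.
Require Import Defs.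
From mathcomp Require Import all_boot all_order all_algebra.
From mathcomp Require Import all_classical all_reals all_analysis.
From mathcomp Require Import ring lra.

Set Implicit Arguments.
Unset Strict Implicit.
Unset Printing Implicit Defensive.

Import GRing.Theory.
Import numFieldNormedType.Exports.
Local Open Scope ring_scope.

(** Throughout, [T X Y Z] stands for [g (torsion nabla X Y) Z].

    Necessity. Splitting the Einstein condition into its parts symmetric and
    skew in the last two arguments expresses [nabla g] and [nabla F] through
    [T] and [A].  The exterior derivative is the cyclic sum of [nabla F] plus
    the cyclic sum of [F (torsion nabla X Y) Z], and in this sum every term
    containing [A] cancels, so that [dF = -3 T] ([einstein_torsion]).  A
    connection is determined by its torsion and the covariant derivative of
    the metric ([koszul_difference]); this gives the formula for [nabla],
    hence uniqueness, and comparing [nabla F] with [nablag F] along this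
    formula gives the condition on [nablag F] ([einstein_cov_levi_civita]).

    Sufficiency. The formula defines a candidate [nabla] through the values
    [g (nabla X Y) Z], linear in [Z] over smooth functions.  The vector
    [nabla X Y] cannot be written in terms of [nablag A] alone: for [X] and
    [Y] in the eigenspace of [A] for [1] and [Z] in the one for [-1], the
    condition only says that [dF X Y Z] is the covariant derivative of [F]
    along [Z], the argument that has to be turned into a vector.  So every
    linear form on vector fields is to be represented by the metric
    ([pseudo_riemannian_riesz]).  The terms of the formula containing [A] are
    symmetric in [X] and [Y], so the torsion is [- dF / 3]; the Einstein
    condition for it then reduces, by skew-symmetry of [dF], to the condition
    on [nablag F].

    Vector fields being derivations, locality has to be derived, and this can
    be done without cut-off functions.  A basis of the tangent space at [p]
    given by fields [E i] has functions [x j] with an invertible matrix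
    [E i (x j)] at [p]; let [D] be its determinant.  For a field [X], the
    combination of the [E i] with the same values as [D *: X] on the [x j] is
    given by Cramer's rule, and the difference vanishes where [D] does not,
    because the tangent spaces have constant dimension.  Multiplied by [D] it
    vanishes everywhere, so [D ^+ 2 *: X] is a combination of the [E i] over
    the whole of [M] ([tangent_basis_local_frame]).  Around each point a form
    is therefore represented up to a smooth factor non-zero at that point, and
    the quotients by these factors agree where they are defined. *)

(** * Values of smooth functions *)

Section Values.
Context {R : realType} {m : nat} {M : manifold R m}.
Local Notation CM := (smooth_fun M).

Lemma smooth_ext (f h : CM) : (forall p, f p = h p) -> f = h.
Proof. by move=> fh; apply: val_inj; apply: funext => p; exact: fh. Qed.

Lemma value0 (p : M) : (0 : CM) p = 0. Proof. by []. Qed.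
Lemma valueD (f h : CM) (p : M) : (f + h) p = f p + h p. Proof. by []. Qed.
Lemma valueN (f : CM) (p : M) : (- f) p = - f p. Proof. by []. Qed.
Lemma valueM (f h : CM) (p : M) : (f * h) p = f p * h p. Proof. by []. Qed.
Lemma valueZ (a : R) (f : CM) (p : M) : (a *: f) p = a * f p. Proof. by []. Qed.

(** Evaluation as a function of [f], so as to be a ring morphism. *)
Definition ev (p : M) (f : CM) : R := f p.

End Values.

(** The operations to be evaluated are matched syntactically: unification
    would unfold the tensors that are to remain atoms. *)
Ltac pointwise :=
  rewrite /ev; repeat match goal with
  | |- context [smooth_val (@GRing.add _ ?f ?h) ?p] => rewrite (valueD f h p)
  | |- context [smooth_val (@GRing.opp _ ?f) ?p] => rewrite (valueN f p)
  | |- context [smooth_val (@GRing.mul _ ?f ?h) ?p] => rewrite (valueM f h p)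
  | |- context [smooth_val (@GRing.scale _ _ ?a ?f) ?p] =>
      rewrite (valueZ a f p)
  | |- context [@smooth_val ?R ?m ?M (@GRing.zero _) ?p] =>
      rewrite (@value0 R m M p)
  end;
  repeat match goal with
  | |- context [@smooth_val ?R ?m ?M ?f ?p] =>
      generalize (@smooth_val R m M f p)
  end; intros.

(** * Local frames *)

Section Evaluation.
Context {R : realType} {m : nat} {M : manifold R m}.
Local Notation CM := (smooth_fun M).
Local Notation XM := (vector_field M).

Lemma field_ext (X Y : XM) : (forall f p, X f p = Y f p) -> X = Y.
Proof.
move=> XY; apply: val_inj; apply: funext => f.
by apply: smooth_ext => p; exact: XY.
Qed.

Lemma ev_is_zmod_morphism (p : M) : zmod_morphism (ev p).
Proof. by []. Qed.

Lemma ev_is_monoid_morphism (p : M) : monoid_morphism (ev p).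
Proof. by []. Qed.

HB.instance Definition _ (p : M) :=
  GRing.isZmodMorphism.Build CM R (ev p) (ev_is_zmod_morphism p).
HB.instance Definition _ (p : M) :=
  GRing.isMonoidMorphism.Build CM R (ev p) (ev_is_monoid_morphism p).

Lemma tangent_at (X : XM) p : is_tangent_vector p (fun f => X f p).
Proof.
have /asboolP[Xl XM] := valP X; split=> [a f h|f h].
  by rewrite [X _](Xl a f h).
by rewrite [X _](XM f h).
Qed.

Lemma sum_fieldE k (a : 'I_k -> CM) (E : 'I_k -> XM) f p :
  (\sum_i a i *: E i) f p = \sum_i a i p * E i f p.
Proof.
pose phi (Y : XM) : R := Y f p.
by apply: (big_morph phi).
Qed.

(** Fewer than [k] functions leave some non-zero combination of the [E i]
    at [p] undetected; by independence some function detects it, and adjoining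
    that function raises the rank. *)
Lemma tangent_basis_coordinates p k (E : 'I_k -> XM) : is_tangent_basis p E ->
  exists x : 'I_k -> CM, \matrix_(i, j) E i (x j) p \in unitmx.
Proof.
move=> Eb.
have indep (c : 'rV[R]_k) : (forall f, \sum_i c ord0 i * E i f p = 0) -> c = 0.
  move=> c0; have tv0 : is_tangent_vector p (fun=> 0).
    by split=> [a f h|f h]; rewrite ?mul0r mulr0 addr0.
  have [c' [_ uniq] ] := Eb _ tv0.
  rewrite -(uniq c); last by move=> f; rewrite c0.
  by apply: uniq => f; rewrite big1 // => i _; rewrite mxE mul0r.
pose B l (x : 'I_l -> CM) := \matrix_(j < l, i < k) E i (x j) p.
suff /(_ k (leqnn k))[x xr] : forall l, (l <= k)%N ->
    exists x : 'I_l -> CM, (l <= \rank (B l x))%N.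
  exists x; rewrite -unitmx_tr -row_free_unit /row_free eqn_leq rank_leq_row.
  by rewrite (_ : _^T = B k x) //; apply/matrixP => i j; rewrite !mxE.
elim=> [|l IH] lk; first by exists (fun=> 0).
have [x xr] := IH (ltnW lk).
have /rowV0Pn[v /sub_kermxP vB v0] : kermx (B l x)^T != 0.
  rewrite kermx_eq0 /row_free mxrank_tr neq_ltn.
  by rewrite (leq_ltn_trans (rank_leq_row _) lk).
have [f vf] : exists f, \sum_i v ord0 i * E i f p != 0.
  apply: contrapT => nf; move/eqP: v0; apply; apply: indep => f.
  by apply: contrapT => /eqP fP; apply: nf; exists f.
exists (fun j : 'I_(1 + l) =>
  match fintype.split j with inl _ => f | inr j' => x j' end).
set y := (fun j => _).
have By : B _ y = col_mx (\row_i E i f p) (B l x).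
  apply/matrixP => i j; rewrite !mxE /y.
  by case: fintype.split => k'; rewrite !mxE.
apply: leq_ltn_trans xr _; rewrite By -(addsmxE (\row_i E i f p)).
apply: rank_ltmx.
rewrite ltmxE addsmxSr /= addsmx_sub submx_refl andbT.
apply: contra vf => /submxP[D DE].
have : (\row_i E i f p) *m v^T = 0 :> 'M[R]_(1, 1).
  by rewrite DE -mulmxA -[B l x]trmxK -trmx_mul vB trmx0 mulmx0.
move/matrixP => /(_ 0 0); rewrite !mxE => w0; apply/eqP; rewrite -[RHS]w0.
by apply: eq_bigr => i _; rewrite !mxE mulrC.
Qed.

(** The [x j] are coordinates wherever the determinant of [E i (x j)] does not
    vanish, so a field killing them is zero there; one more factor of this
    determinant makes it zero everywhere, without any cut-off function. *)
Lemma tangent_basis_local_frame p k (E : 'I_k -> XM) : is_tangent_basis p E ->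
  (forall q, exists E' : 'I_k -> XM, is_tangent_basis q E') ->
  exists2 d : CM, d p != 0 &
    forall X, exists t : 'I_k -> CM, d *: X = \sum_i t i *: E i.
Proof.
move=> Eb Tb; have [x xu] := tangent_basis_coordinates Eb.
pose B : 'M[CM]_k := \matrix_(i, j) E i (x j).
have Bq q : (\det B) q = \det (\matrix_(i, j) E i (x j) q).
  rewrite -[LHS]/(ev q _) -det_map_mx; congr (\det _).
  by apply/matrixP => i j; rewrite !mxE.
exists (\det B * \det B).
  rewrite -[_ p]/(\det B p * \det B p) Bq mulf_neq0 //;
  by rewrite -unitfE -unitmxE.
move=> X; pose t := (\row_j X (x j)) *m \adj B.
(* Cramer's rule: [X'] kills all the [x j]. *)
pose X' := \det B *: X - \sum_i t ord0 i *: E i.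
have X'x j q : X' (x j) q = 0.
  rewrite -[LHS]/(\det B q * X (x j) q - (\sum_i t ord0 i *: E i) (x j) q).
  have /matrixP/(_ ord0 j) : t *m B = \det B *: (\row_j X (x j)).
    by rewrite /t -mulmxA mul_adj_mx mul_mx_scalar.
  rewrite !mxE => /(congr1 (ev q)); rewrite rmorphM rmorph_sum /= => tE.
  rewrite sum_fieldE -[\det B q * _]tE; apply/eqP.
  by rewrite subr_eq0; apply/eqP/eq_bigr => i _; rewrite !mxE.
have X'0 : \det B *: X' = 0.
  apply: field_ext => f q; rewrite -[LHS]/(\det B q * X' f q) -[RHS]/(0 : R).
  have [->|Dq] := eqVneq (\det B q) 0; first by rewrite mul0r.
  have [E' E'b] := Tb q; have [c [cX' _] ] := E'b _ (tangent_at X' q).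
  rewrite cX' big1 ?mulr0 // => i _; suff -> : c = 0 by rewrite mxE mul0r.
  (* The [E i] span at [q], as there are [k] of them and they are independent:
     they are expressed in a basis [E'] by an invertible matrix [C]. *)
  have /choice[C CE] i0 : exists c0 : 'rV[R]_k,
      forall f, E i0 f q = \sum_i c0 ord0 i * E' i f q.
    by have [c0 [c0E _] ] := E'b _ (tangent_at (E i0) q); exists c0.
  pose B' := \matrix_(i, j) E' i (x j) q.
  have BE : \matrix_(i, j) E i (x j) q = (\matrix_(i, j) C i ord0 j) *m B'.
    apply/matrixP => a b; rewrite !mxE CE.
    by apply: eq_bigr => ? _; rewrite !mxE.
  have B'u : B' \in unitmx.
    move: Dq; rewrite Bq BE det_mulmx mulf_eq0 negb_or => /andP[_].
    by rewrite unitmxE unitfE.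
  rewrite -[c](mulmxK B'u); suff -> : c *m B' = 0 by rewrite mul0mx.
  apply/matrixP => a j; rewrite !mxE -[RHS](X'x j q) cX'.
  by apply: eq_bigr => ? _; rewrite (ord1 a) !mxE.
exists (fun i => \det B * t ord0 i); apply/eqP; rewrite -subr_eq0; apply/eqP.
rewrite -[RHS]X'0 /X' scalerBr scalerA scaler_sumr; congr (_ - _).
by apply: eq_bigr => i _; rewrite scalerA.
Qed.

End Evaluation.

(** * Quotients of smooth functions *)

Section SmoothQuotient.
Context {R : realType}.

Lemma Ck_on_local (V W : normedModType R) k (U : set V) (f : V -> W) :
  (forall x, U x -> exists2 N : set V, N x & Ck_on k N f) -> Ck_on k U f.
Proof.
elim: k f => [|k IH] f floc.
  by move=> x /floc[N Nx]; apply.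
split=> [x /floc[N Nx [df _] ]|v]; first exact: df.
by apply: IH => x /floc[N Nx [_ Df] ]; exists N => //; exact: Df.
Qed.

Lemma Ck_on_subset (V W : normedModType R) k (N U : set V) (f : V -> W) :
  (N `<=` U)%classic -> Ck_on k U f -> Ck_on k N f.
Proof. by move=> NU fC; apply: Ck_on_local => x /NU Ux; exists U. Qed.

Lemma Ck_onV (V : normedModType R) k (U : set V) (f : V -> R) : open U ->
  (forall x, U x -> f x != 0) -> Ck_on k U f ->
  Ck_on k U (fun x => (f x)^-1).
Proof.
move=> oU f0; elim: k => [|k IH] fC.
  by move=> x Ux; apply: cvgV; [exact: f0|exact: fC].
have [df Df] := fC; split=> [x Ux|v].
  by apply: differentiableV; [exact: df|exact: f0].
have fVC := IH (Ck_onW fC).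
pose h x := (f x)^-1.
have DV : Ck_on k U (cst 0 - h * h * 'D_v f).
  apply: Ck_onB => //; first exact: Ck_on_cst.
  by apply: Ck_onM (Df v) => //; apply: Ck_onM.
apply: (Ck_on_ext oU) DV => x Ux.
rewrite deriveV ?f0 //; last exact/diff_derivable/df.
rewrite -[LHS]/(0 - (f x)^-1 * (f x)^-1 * 'D_v f x).
rewrite -[RHS]/(- f x ^- 2 * 'D_v f x).
by rewrite sub0r -expr2 exprVn mulNr.
Qed.

End SmoothQuotient.

(** * Representation of linear forms by the metric *)

Section Musical.
Context {R : realType} {m : nat} {M : manifold R m}.
Local Notation CM := (smooth_fun M).
Local Notation XM := (vector_field M).

(** Smoothness is local, so the denominators may vary from point to point. *)
Lemma smooth_local_quotient (u : M -> R) :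
  (forall p, exists a b : CM, a p != 0 /\
     forall q, a q != 0 -> u q = b q / a q) -> u \in @smooth_pred R m M.
Proof.
move=> uloc; apply/asboolP => c cA k; apply: Ck_on_local => x Ux.
have [a [b [ap ab] ] ] := uloc (chart_inv c x).
have /asboolP/(_ c cA) aS := valP a; have /asboolP/(_ c cA) bS := valP b.
pose N := (chart_img c `&` (a \o chart_inv c) @^-1` [set y | y != 0])%classic.
have oN : open N.
  rewrite openE => y [Uy ay]; apply: filterI.
    by apply: open_nbhs_nbhs; split => //; exact: chart_img_open.
  apply: (aS 0%N y Uy); apply: open_nbhs_nbhs; split => //.
exists N; first by [].
have NU : (N `<=` chart_img c)%classic by move=> y [].
have abC : Ck_on k N ((b \o chart_inv c) * (fun y => (a (chart_inv c y))^-1)).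
  apply: Ck_onM => //; first exact: Ck_on_subset (bS k).
  by apply: Ck_onV => //; [move=> y []|exact: Ck_on_subset (aS k)].
by apply: (Ck_on_ext oN) abC => y [_ ay]; rewrite /= ab.
Qed.

Lemma scalar_sum k (w : XM -> CM) (t : 'I_k -> CM) (E : 'I_k -> XM) :
  scalar w -> w (\sum_i t i *: E i) = \sum_i t i * w (E i).
Proof.
move=> ws.
pose W : {scalar XM} := HB.pack w (GRing.isLinear.Build _ _ _ _ w ws).
rewrite -[w]/(W : _ -> _) linear_sum; apply: eq_bigr => i _.
by rewrite linearZ.
Qed.

Lemma scalarMl (w : XM -> CM) (a : CM) X : scalar w -> w (a *: X) = a * w X.
Proof.
move=> ws.
pose W : {scalar XM} := HB.pack w (GRing.isLinear.Build _ _ _ _ w ws).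
by rewrite -[w]/(W : _ -> _) linearZ.
Qed.

Context (g : XM -> XM -> CM) (r s : nat).
Hypothesis gP : is_pseudo_riemannian g r s.

(** At [p] itself the Gram matrix is diagonal with entries [1] and [-1]. *)
Lemma pseudo_riemannian_local_frame p : exists E : 'I_(r + s) -> XM,
  [/\ exists2 d : CM, d p != 0 &
        forall X, exists t : 'I_(r + s) -> CM, d *: X = \sum_i t i *: E i
    & (\det (\matrix_(i, j) g (E i) (E j))) p != 0].
Proof.
have [_ _ gsig] := gP; have [E [Eb gE] ] := gsig p; exists E; split.
  apply: tangent_basis_local_frame Eb _ => q.
  by have [E' [E'b _] ] := gsig q; exists E'.
rewrite -[_ p]/(ev p _) -det_map_mx.
have -> : map_mx (ev p) (\matrix_(i, j) g (E i) (E j)) =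
    diag_mx (\row_(i < r + s) if (i < r)%N then 1 else -1).
  by apply/matrixP => i j; rewrite !mxE /ev gE; case: eqP.
rewrite det_diag; apply/prodf_neq0 => i _; rewrite mxE.
by case: ifP; rewrite ?oppr_eq0 oner_eq0.
Qed.

Lemma pseudo_riemannian_nondegenerate X : (forall Z, g X Z = 0) -> X = 0.
Proof.
move=> gX0; have [ [_ gl] _ _] := gP.
apply: field_ext => f p; rewrite -[RHS]/(0 : R).
have [E [ [d dp dE] ] ] := pseudo_riemannian_local_frame p.
set H := \matrix_(i, j) _ => hp.
have [t tE] := dE X.
have tH : (\row_i t i) *m H = 0.
  apply/matrixP => i j; rewrite !mxE.
  have := scalarMl d X (gl (E j)); rewrite gX0 mulr0 tE => tE0.
  rewrite -[RHS]tE0 (scalar_sum _ _ (gl (E j))).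
  by apply: eq_bigr => l _; rewrite !mxE.
have ht i : \det H * t i = 0.
  have : \det H *: \row_i t i = 0.
    by rewrite -mul_mx_scalar -mul_mx_adj mulmxA tH mul0mx.
  by move=> /matrixP/(_ ord0 i); rewrite !mxE.
have hdX : (\det H * d) *: X = 0.
  rewrite -scalerA tE scaler_sumr big1 // => i _.
  by rewrite scalerA ht scale0r.
have : (\det H p * d p) * X f p = 0.
  by rewrite -[LHS]/(((\det H * d) *: X) f p) hdX.
by move/eqP; rewrite !mulf_eq0 (negPf hp) (negPf dp) /= => /eqP.
Qed.

(** The Gram matrix is inverted by its adjugate, which costs the factor
    [\det H]; passing from the frame to all fields costs the factor [d]. *)
Lemma pseudo_riemannian_local_riesz (w : XM -> CM) p : scalar w ->
  exists (a : CM) (V : XM), a p != 0 /\ forall Z, g V Z = a * w Z.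
Proof.
move=> ws; have [ [gr gl] _ _] := gP.
have [E [ [d dp dE] ] ] := pseudo_riemannian_local_frame p.
set H := \matrix_(i, j) _ => hp.
pose u := (\row_i w (E i)) *m \adj H.
pose V := \sum_i u ord0 i *: E i.
have gV j : g V (E j) = \det H * w (E j).
  rewrite /V (scalar_sum _ _ (gl (E j))).
  have /matrixP/(_ ord0 j) : u *m H = \det H *: \row_i w (E i).
    by rewrite /u -mulmxA mul_adj_mx mul_mx_scalar.
  by rewrite !mxE => <-; apply: eq_bigr => i _; rewrite !mxE.
exists (\det H * d), (d *: V); split; first exact: mulf_neq0.
move=> Z; have [t tE] := dE Z.
rewrite (scalarMl _ _ (gl Z)) -(scalarMl _ _ (gr V)) tE (scalar_sum _ _ (gr V)).
rewrite -mulrA -(scalarMl _ _ ws) tE (scalar_sum _ _ ws) mulr_sumr.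
by apply: eq_bigr => i _; rewrite gV mulrCA.
Qed.

(** Local representatives [V p] of [a p * w] are glued by dividing by [a p];
    nondegeneracy makes the quotients agree on overlaps. *)
Lemma pseudo_riemannian_riesz (w : XM -> CM) : scalar w ->
  exists V : XM, forall Z, g V Z = w Z.
Proof.
move=> ws; have [ [gr gl] _ _] := gP.
have /choice[a /choice[V aV] ] p := pseudo_riemannian_local_riesz p ws.
have ap p : a p p != 0 by have [] := aV p.
have gV p Z : g (V p) Z = a p * w Z by have [] := aV p.
have Vcomp p q : a q *: V p = a p *: V q.
  apply/eqP; rewrite -subr_eq0; apply/eqP.
  apply: pseudo_riemannian_nondegenerate => Z.
  rewrite -scaleN1r addrC gl !(scalarMl _ _ (gl Z)) !gV mulN1r.
  by rewrite mulrCA addNr.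
pose Vf (f : CM) (p : M) := V p f p / a p p.
have VfE f p q : a p q != 0 -> Vf f q = V p f q / a p q.
  move=> apq; apply/eqP; rewrite eqr_div // mulrC [eqbRHS]mulrC; apply/eqP.
  by rewrite -[LHS]/((a p *: V q) f q) -Vcomp.
have Vf_smooth f : Vf f \in @smooth_pred R m M.
  apply: smooth_local_quotient => p; exists (a p), (V p f).
  by split => // q; exact: VfE.
pose D (f : CM) : CM^o := SmoothFun (Vf_smooth f).
have DP : D \in @derivation_pred R m M.
  apply/asboolP; split=> [c f h|f h]; apply: smooth_ext => p.
    have [Vl _] := tangent_at (V p) p.
    rewrite -[LHS]/(Vf _ p) /Vf Vl.
    by rewrite mulrDl -mulrA.
  have [_ VM] := tangent_at (V p) p.
  rewrite -[LHS]/(Vf _ p) /Vf VM -[RHS]/(Vf f p * h p + f p * Vf h p) /Vf.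
  by rewrite mulrDl mulrAC mulrA.
pose X : XM := VectorField DP.
(* The second factor [a p] covers the points where [a p] vanishes. *)
have XE p : (a p * a p) *: X = a p *: V p.
  apply: field_ext => f q; rewrite -[LHS]/(a p q * a p q * Vf f q).
  rewrite -[RHS]/(a p q * V p f q).
  have [->|apq] := eqVneq (a p q) 0; first by rewrite !mul0r.
  by rewrite (VfE f p) // -mulrA (mulrC (V p f q)) mulVKf.
exists X => Z; apply: smooth_ext => p.
have := congr1 (fun Y => g Y Z p) (XE p).
rewrite /= !(scalarMl _ _ (gl Z)) gV mulrA => /(mulfI _); apply.
by rewrite mulf_neq0 ?ap.
Qed.

End Musical.

(** * Covariant and exterior derivatives of bilinear forms *)

Section Connections.
Context {R : realType} {m : nat} {M : manifold R m}.
Local Notation CM := (smooth_fun M).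
Local Notation XM := (vector_field M).

Lemma scalarD (w : XM -> CM) X Y : scalar w -> w (X + Y) = w X + w Y.
Proof. by move=> ws; rewrite -[X in X + Y]scale1r ws mul1r. Qed.

Lemma scalarN (w : XM -> CM) X : scalar w -> w (- X) = - w X.
Proof. by move=> ws; rewrite -scaleN1r (scalarMl _ _ ws) mulN1r. Qed.

Lemma fieldD (X : XM) (f h : CM) : X (f + h) = (X f : CM) + X h.
Proof.
have /asboolP[Xl _] := valP X.
by rewrite -[f in LHS]scale1r [LHS]Xl scale1r.
Qed.

Lemma fieldN (X : XM) (f : CM) : X (- f) = - (X f : CM).
Proof.
have X0 : X 0 = 0 :> CM by apply: (addrI (X 0)); rewrite -fieldD !addr0.
by apply: (addrI (X f : CM)); rewrite -fieldD !subrr.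
Qed.

Lemma fieldM (X : XM) (f h : CM) : X (f * h) = (X f : CM) * h + f * X h.
Proof. by have /asboolP[_ XM] := valP X; exact: XM. Qed.

Lemma bracketC (X Y : XM) : [[Y, X]] = - [[X, Y]].
Proof.
by apply: field_ext => f p; rewrite -[RHS]/(- (X (Y f) p - Y (X f) p)) opprB.
Qed.

Lemma torsionC (nabla : connection M) X Y :
  torsion nabla Y X = - torsion nabla X Y.
Proof. by rewrite /torsion bracketC !opprB opprK addrC addrA. Qed.

Section Forms.
Context (B : XM -> XM -> CM).
Hypothesis Bbil : is_bilinear_form B.

Lemma formDl X Y Z : B (X + Y) Z = B X Z + B Y Z.
Proof. exact: scalarD (Bbil.2 Z). Qed.
Lemma formNl X Z : B (- X) Z = - B X Z.
Proof. exact: scalarN (Bbil.2 Z). Qed.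
Lemma formMl f X Z : B (f *: X) Z = f * B X Z.
Proof. exact: scalarMl (Bbil.2 Z). Qed.
Lemma formDr X Y Z : B X (Y + Z) = B X Y + B X Z.
Proof. exact: scalarD (Bbil.1 X). Qed.
Lemma formNr X Z : B X (- Z) = - B X Z.
Proof. exact: scalarN (Bbil.1 X). Qed.
Lemma formMr f X Z : B X (f *: Z) = f * B X Z.
Proof. exact: scalarMl (Bbil.1 X). Qed.
Definition formE := (formDl, formNl, formMl, formDr, formNr, formMr).

Lemma cov_form_scalarl nabla Y Z : scalar (fun X => cov_form nabla B X Y Z).
Proof.
move=> f X X'; rewrite /cov_form !cov_linear !formE.
apply: smooth_ext => p; rewrite -[(f *: X + X') _]/(f * X _ + X' _).
by pointwise; ring.
Qed.

Lemma cov_form_scalarr nabla X Y : scalar (cov_form nabla B X Y).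
Proof.
move=> f Z Z'; rewrite /cov_form !(cov_additive, cov_leibniz) !formE.
by apply: smooth_ext => p; rewrite fieldD fieldM; pointwise; ring.
Qed.

Lemma cov_form_sym nabla X Y Z : (forall X Y, B X Y = B Y X) ->
  cov_form nabla B X Y Z = cov_form nabla B X Z Y.
Proof.
move=> Bs; rewrite /cov_form (Bs Y Z) (Bs _ Z) (Bs Y).
by apply: smooth_ext => p; pointwise; ring.
Qed.

Lemma cov_form_skew nabla X Y Z : (forall X Y, B X Y = - B Y X) ->
  cov_form nabla B X Y Z = - cov_form nabla B X Z Y.
Proof.
move=> Bs; rewrite /cov_form (Bs Y Z) (Bs _ Z) (Bs Y).
by apply: smooth_ext => p; rewrite fieldN; pointwise; ring.
Qed.

(** In the difference of the two sides all terms in [nabla] cancel pairwise by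
    skew-symmetry, and the brackets come from the torsion. *)
Lemma ext_deriv_torsion (nabla : connection M) X Y Z :
  (forall X Y, B X Y = - B Y X) ->
  ext_deriv B X Y Z =
    cov_form nabla B X Y Z + cov_form nabla B Y Z X + cov_form nabla B Z X Y
    + B (torsion nabla X Y) Z + B (torsion nabla Y Z) X
    + B (torsion nabla Z X) Y.
Proof.
move=> Bs; rewrite /ext_deriv /cov_form /torsion !formE.
rewrite (Bs X (nabla Z Y)) (Bs Y (nabla X Z)) (Bs Z (nabla Y X)).
by apply: smooth_ext => p; pointwise; ring.
Qed.

Section TorsionFree.
Context (nabla : connection M).
Hypotheses (Bskew : forall X Y, B X Y = - B Y X)
  (torsion_free : forall X Y, torsion nabla X Y = 0).
Local Notation dB := (ext_deriv B).

Lemma ext_deriv_torsion_free X Y Z :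
  dB X Y Z = cov_form nabla B X Y Z + cov_form nabla B Y Z X
    + cov_form nabla B Z X Y.
Proof.
rewrite (ext_deriv_torsion nabla) // !torsion_free.
have B0 W : B 0 W = 0 by rewrite -(scale0r 0) formMl mul0r.
by rewrite !B0 !addr0.
Qed.

Lemma ext_deriv_swap12 X Y Z : dB Y X Z = - dB X Y Z.
Proof.
rewrite !ext_deriv_torsion_free; apply: smooth_ext => p.
rewrite (cov_form_skew nabla Y X Z Bskew) (cov_form_skew nabla X Z Y Bskew).
by rewrite (cov_form_skew nabla Z Y X Bskew); pointwise; ring.
Qed.

Lemma ext_deriv_swap23 X Y Z : dB X Z Y = - dB X Y Z.
Proof.
rewrite !ext_deriv_torsion_free; apply: smooth_ext => p.
rewrite (cov_form_skew nabla Y X Z Bskew) (cov_form_skew nabla X Z Y Bskew).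
by rewrite (cov_form_skew nabla Z Y X Bskew); pointwise; ring.
Qed.

(** Derivatives of the coefficients cancel, since a torsion-free connection
    writes [dB] as a sum of tensors. *)
Lemma ext_deriv_scalar3 X Y : scalar (dB X Y).
Proof.
move=> f Z Z'; rewrite !ext_deriv_torsion_free.
rewrite (cov_form_scalarr nabla X Y) (cov_form_scalarl nabla X Y).
rewrite !(cov_form_skew nabla Y _ X Bskew) (cov_form_scalarr nabla Y X).
by apply: smooth_ext => p; pointwise; ring.
Qed.

Lemma ext_deriv_scalar2 X Z : scalar (fun Y => dB X Y Z).
Proof.
move=> f Y Y'; rewrite !(ext_deriv_swap23 X Z) (ext_deriv_scalar3 X Z).
by apply: smooth_ext => p; pointwise; ring.
Qed.

Lemma ext_deriv_scalar1 Y Z : scalar (fun X => dB X Y Z).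
Proof.
move=> f X X'; rewrite !(ext_deriv_swap12 Y) (ext_deriv_scalar2 Y Z).
by apply: smooth_ext => p; pointwise; ring.
Qed.

End TorsionFree.

End Forms.

(** Koszul's argument: the difference of the two connections has its part
    symmetric in the last two arguments given by [cov_form nabla g], its part
    skew in the first two by the torsion. *)
Lemma koszul_difference (g : XM -> XM -> CM) (nablag nabla : connection M) :
  is_bilinear_form g -> (forall X Y, g X Y = g Y X) ->
  is_levi_civita g nablag ->
  forall X Y Z,
  2 *: (g (nabla X Y) Z - g (nablag X Y) Z) =
    cov_form nabla g Z X Y - cov_form nabla g X Y Z - cov_form nabla g Y Z X
    + g (torsion nabla X Y) Z + g (torsion nabla Z X) Y
    - g (torsion nabla Y Z) X.
Proof.
move=> gb gs [T0 Q0] X Y Z; apply: smooth_ext => p.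
have LC U V W : g (nablag U V) W - g (nablag V U) W - g ([[U, V]]) W = 0.
  rewrite -!(formE gb) -[X in g X]/(torsion nablag U V) T0.
  by rewrite -(scale0r 0) (formE gb) mul0r.
have := congr1 (ev p) (LC X Y Z); have := congr1 (ev p) (LC Y Z X).
have := congr1 (ev p) (LC Z X Y).
have := congr1 (ev p) (Q0 X Y Z); have := congr1 (ev p) (Q0 Y Z X).
have := congr1 (ev p) (Q0 Z X Y).
rewrite /cov_form /torsion !(formE gb).
rewrite (gs X (nabla Z Y)) (gs Y (nabla X Z)) (gs Z (nabla Y X)).
rewrite (gs X (nablag Z Y)) (gs Y (nablag X Z)) (gs Z (nablag Y X)).
pointwise; lra.
Qed.

End Connections.

(** * Einstein connections on almost paracontact metric manifolds *)

Section AlmostParacontact.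
Context {R : realType} {n : nat} {M : manifold R n.*2.+1}.
Context (S : almost_paracontact_metric M).
Local Notation CM := (smooth_fun M).
Local Notation XM := (vector_field M).
Local Notation g := (apc_metric S).
Local Notation A := (apc_endo S).
Local Notation eta := (apc_form S).
Local Notation F := (fundamental_form S).
Local Notation dF := (ext_deriv F).

Lemma apc_bilinear : is_bilinear_form g.
Proof. by have [] := apc_metricP S. Qed.

Lemma apc_sym X Y : g X Y = g Y X.
Proof. by have [] := apc_metricP S. Qed.

Lemma apc_metric_inj X Y : (forall Z, g X Z = g Y Z) -> X = Y.
Proof.
move=> XY; apply/eqP; rewrite -subr_eq0; apply/eqP.
apply: (pseudo_riemannian_nondegenerate (apc_metricP S)) => Z.
by rewrite !(formE apc_bilinear) XY subrr.
Qed.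

(** [A (A (A X))] computed as the square of [A] at [A X], and as the image
    under [A] of its square at [X], gives [eta (A X) *: apc_field S = 0]. *)
Lemma apc_form_endo X : eta (A X) = 0.
Proof.
have := apc_endo2 S (A X); rewrite (apc_endo2 S X) linearB linearZ /=.
rewrite apc_endo_field scaler0 subr0 => /eqP.
rewrite -subr_eq0 opprB addrCA subrr addr0 => /eqP/(congr1 eta).
by rewrite linearZ /= apc_form_field mulr1 linear0.
Qed.

Lemma apc_endo_skew X Y : g (A X) Y = - g X (A Y).
Proof.
have := apc_compatible S X (A Y).
rewrite apc_form_endo mulr0 addr0 => <-.
rewrite apc_endo2 !(formE apc_bilinear).
by rewrite -apc_formE apc_form_endo mulr0 subr0.
Qed.

Lemma fundamental_form_skew X Y : F X Y = - F Y X.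
Proof. by rewrite /fundamental_form apc_endo_skew apc_sym. Qed.

Lemma fundamental_form_bilinear : is_bilinear_form F.
Proof.
split=> [X|Y] f Z Z'; rewrite /fundamental_form.
  by rewrite (apc_bilinear.1 (A X)).
by rewrite linearP !(formE apc_bilinear).
Qed.

(** A metric connection commutes with lowering an index. *)
Lemma cov_form_fundamental (nabla : connection M) X Y Z :
  (forall X Y Z, cov_form nabla g X Y Z = 0) ->
  cov_form nabla F X Y Z = g (cov_endo nabla A X Y) Z.
Proof.
move=> Q0; apply: smooth_ext => p; have := congr1 (ev p) (Q0 X (A Y) Z).
rewrite /cov_form /fundamental_form /cov_endo.
rewrite !(formE apc_bilinear); pointwise; lra.
Qed.

Context (nablag : connection M).
Hypothesis hLC : is_levi_civita g nablag.

Section Admissible.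
Context (nabla : connection M).
Local Notation T X Y Z := (g (torsion nabla X Y) Z).
Hypothesis Tskew : has_skew_torsion g nabla.
Hypothesis Einstein : einstein_metricity (fun X Y => g X Y + F X Y) nabla.

Lemma skew_torsion_swap12 X Y Z : T Y X Z = - T X Y Z.
Proof. by rewrite torsionC (formE apc_bilinear). Qed.

Lemma skew_torsion_rot X Y Z : T Y Z X = T X Y Z.
Proof. by rewrite Tskew skew_torsion_swap12 opprK. Qed.

(** The Einstein condition with [F (torsion nabla X Y) Z] rewritten by
    skewness of [A]; [nabla g] and [nabla F] are the parts of the left-hand side
    symmetric and skew in [Y], [Z]. *)
Lemma einstein_split X Y Z :
  cov_form nabla g X Y Z + cov_form nabla F X Y Z = - T X Y Z + T X Y (A Z).
Proof.
apply: smooth_ext => p; have := congr1 (ev p) (Einstein X Y Z).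
rewrite /cov_form /fundamental_form fieldD (apc_endo_skew (torsion nabla X Y)).
by pointwise; lra.
Qed.

Lemma einstein_cov_metric X Y Z :
  2 *: cov_form nabla g X Y Z = T X Y (A Z) - T X (A Y) Z.
Proof.
apply: smooth_ext => p.
have := congr1 (ev p) (einstein_split X Y Z).
have := congr1 (ev p) (einstein_split X Z Y).
rewrite (cov_form_sym _ _ _ _ apc_sym).
rewrite (cov_form_skew nabla X Z Y fundamental_form_skew).
rewrite (Tskew X Z Y) (Tskew X Z (A Y)); pointwise; lra.
Qed.

Lemma einstein_cov_fundamental X Y Z :
  2 *: cov_form nabla F X Y Z = T X Y (A Z) + T X (A Y) Z - 2 *: T X Y Z.
Proof.
apply: smooth_ext => p.
have := congr1 (ev p) (einstein_split X Y Z).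
have := congr1 (ev p) (einstein_cov_metric X Y Z).
pointwise; lra.
Qed.

(** The cyclic sum of [nabla F] is [-3 T X Y Z] plus the cyclic sum of
    [T X Y (A Z)]; the torsion terms in [dF] are the opposite of the latter. *)
Lemma einstein_torsion X Y Z : T X Y Z = - (3^-1 *: dF X Y Z).
Proof.
apply: smooth_ext => p.
have := congr1 (ev p) (einstein_cov_fundamental X Y Z).
have := congr1 (ev p) (einstein_cov_fundamental Y Z X).
have := congr1 (ev p) (einstein_cov_fundamental Z X Y).
rewrite (skew_torsion_rot Z X (A Y)) (skew_torsion_rot X Y (A Z)).
rewrite (skew_torsion_rot Y Z (A X)) (skew_torsion_rot X Y Z).
rewrite -(skew_torsion_rot Z X Y).
rewrite (ext_deriv_torsion fundamental_form_bilinear nabla X Y Z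
  fundamental_form_skew).
have FE U V W : F (torsion nabla U V) W = - T U V (A W).
  exact: apc_endo_skew.
rewrite !FE; pointwise; lra.
Qed.

Lemma einstein_cov_metric_ext X Y Z :
  cov_form nabla g X Y Z = - (6^-1 *: (dF X Y (A Z) - dF X (A Y) Z)).
Proof.
apply: smooth_ext => p; have := congr1 (ev p) (einstein_cov_metric X Y Z).
by rewrite !einstein_torsion; pointwise; lra.
Qed.

Lemma einstein_cov_fundamental_ext X Y Z :
  cov_form nabla F X Y Z =
    6^-1 *: (2 *: dF X Y Z - dF X Y (A Z) - dF X (A Y) Z).
Proof.
apply: smooth_ext => p; have := congr1 (ev p) (einstein_cov_fundamental X Y Z).
by rewrite !einstein_torsion; pointwise; lra.
Qed.

Lemma einstein_connection X Y Z :
  g (nabla X Y) Z - g (nablag X Y) Z =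
    - (6^-1 *: dF X Y Z) - 6^-1 *: dF X (A Y) Z + 6^-1 *: dF (A X) Y Z.
Proof.
apply: smooth_ext => p.
have := congr1 (ev p) (koszul_difference nabla apc_bilinear apc_sym hLC X Y Z).
have := congr1 (ev p) (einstein_cov_metric X Y Z).
have := congr1 (ev p) (einstein_cov_metric Y Z X).
have := congr1 (ev p) (einstein_cov_metric Z X Y).
have := congr1 (ev p) (einstein_torsion X Y Z).
have := congr1 (ev p) (einstein_torsion X (A Y) Z).
have := congr1 (ev p) (einstein_torsion (A X) Y Z).
rewrite (skew_torsion_rot Z X (A Y)) (skew_torsion_rot X Y (A Z)).
rewrite (skew_torsion_rot Y Z (A X)) (skew_torsion_rot X Y Z).
rewrite -(skew_torsion_rot (A X) Y Z) (skew_torsion_rot Z X Y).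
pointwise; lra.
Qed.

Lemma einstein_cov_levi_civita X Y Z :
  cov_form nablag F X Y Z =
    3^-1 *: dF X Y Z + 3^-1 *: dF X (A Y) (A Z)
    - 6^-1 *: dF (A X) Y (A Z) - 6^-1 *: dF (A X) (A Y) Z.
Proof.
apply: smooth_ext => p.
have := congr1 (ev p) (einstein_cov_fundamental X Y Z).
have := congr1 (ev p) (einstein_connection X Y (A Z)).
have := congr1 (ev p) (einstein_connection X Z (A Y)).
rewrite /cov_form.
have FEl U V W : F (cov nabla U V) W = - g (nabla U V) (A W).
  exact: apc_endo_skew.
have FEr U V W : F W (cov nabla U V) = g (nabla U V) (A W).
  exact: apc_sym.
have FElg U V W : F (cov nablag U V) W = - g (nablag U V) (A W).
  exact: apc_endo_skew.
have FErg U V W : F W (cov nablag U V) = g (nablag U V) (A W).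
  exact: apc_sym.
rewrite !FEl !FEr !FElg !FErg.
have dFE U V W : dF U V W = (-3) *: T U V W.
  by apply: smooth_ext => q; rewrite einstein_torsion; pointwise; lra.
rewrite !dFE (Tskew X Z (A Y)) (Tskew X (A Z) (A Y)) (Tskew (A X) Z (A Y)).
rewrite (Tskew X (A Y) Z); pointwise; lra.
Qed.

End Admissible.

Section Existence.
Let dF_swap12 :=
  ext_deriv_swap12 fundamental_form_bilinear fundamental_form_skew hLC.1.
Let dF_swap23 :=
  ext_deriv_swap23 fundamental_form_bilinear fundamental_form_skew hLC.1.
Let dF_scalar1 :=
  ext_deriv_scalar1 fundamental_form_bilinear fundamental_form_skew hLC.1.
Let dF_scalar2 :=
  ext_deriv_scalar2 fundamental_form_bilinear fundamental_form_skew hLC.1.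
Let dF_scalar3 :=
  ext_deriv_scalar3 fundamental_form_bilinear fundamental_form_skew hLC.1.

(** The difference to the Levi-Civita connection prescribed by
    [einstein_connection]. *)
Let delta X Y Z : CM :=
  - (6^-1 *: (dF X Y Z + dF X (A Y) Z - dF (A X) Y Z)).

Hypothesis dFcond : forall X Y Z, cov_form nablag F X Y Z =
    3^-1 *: dF X Y Z + 3^-1 *: dF X (A Y) (A Z)
    - 6^-1 *: dF (A X) Y (A Z) - 6^-1 *: dF (A X) (A Y) Z.

Lemma einstein_connection_exists : exists nabla : connection M,
  einstein_metricity (fun X Y => g X Y + F X Y) nabla /\
  has_skew_torsion g nabla.
Proof.
have /choice[D gD] : forall XY : XM * XM,
    exists V : XM, forall Z, g V Z = delta XY.1 XY.2 Z.
  move=> XY; apply: (pseudo_riemannian_riesz (apc_metricP S)) => f Z Z'.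
  rewrite /delta !dF_scalar3.
  by apply: smooth_ext => p; pointwise; ring.
have gDE X Y Z : g (D (X, Y)) Z = delta X Y Z by exact: gD (X, Y) Z.
pose cv X Y := nablag X Y + D (X, Y).
have cv_lin Y : linear (cv ^~ Y).
  move=> f X X'; apply: apc_metric_inj => Z; rewrite /cv cov_linear.
  rewrite !(formE apc_bilinear) !gDE /delta /= linearP.
  rewrite !(dF_scalar1 _ Z).
  by apply: smooth_ext => p; pointwise; ring.
have cv_D X Y f Y' : D (X, f *: Y + Y') = f *: D (X, Y) + D (X, Y').
  apply: apc_metric_inj => Z.
  rewrite !(formE apc_bilinear) !gDE /delta /= linearP !(dF_scalar2 _ Z).
  by apply: smooth_ext => p; pointwise; ring.
have cv_add X Y Y' : cv X (Y + Y') = cv X Y + cv X Y'.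
  rewrite /cv cov_additive -[W in D (X, W + _)]scale1r cv_D scale1r.
  by rewrite addrACA.
have cv_leib X (f : CM) Y : cv X (f *: Y) = X f *: Y + f *: cv X Y.
  have D0 : D (X, 0) = 0.
    apply: (addrI (D (X, 0))).
    by have := cv_D X 0 1 0; rewrite !scale1r !addr0.
  rewrite /cv cov_leibniz -[W in D (_, W)]addr0 cv_D D0 addr0.
  by rewrite scalerDr addrA.
pose nabla := Connection cv_lin cv_add cv_leib.
have nablaE X Y : nabla X Y = nablag X Y + D (X, Y) by [].
(* The part of [delta] containing [A] is symmetric in [X] and [Y], so the
   torsion does not see it. *)
have TE X Y Z : g (torsion nabla X Y) Z = - (3^-1 *: dF X Y Z).
  have -> : torsion nabla X Y = torsion nablag X Y + D (X, Y) - D (Y, X).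
    rewrite /torsion !nablaE; apply: field_ext => f p.
    pose e (X : XM) : R := X f p.
    have eD U V : e (U + V) = e U + e V by [].
    have eN U : e (- U) = - e U by [].
    rewrite -!/(e _) !(eD, eN); ring.
  rewrite hLC.1 add0r !(formE apc_bilinear) !gDE /delta /=.
  rewrite (dF_swap12 X Y) (dF_swap12 X (A Y)) (dF_swap12 (A X) Y).
  by apply: smooth_ext => p; pointwise; lra.
exists nabla; split; last first.
  by move=> X Y Z; rewrite !TE dF_swap23 scalerN opprK.
move=> X Y Z.
have -> : cov_form nabla (fun X Y => g X Y + F X Y) X Y Z =
    cov_form nablag g X Y Z + cov_form nablag F X Y Z
    - delta X Y Z - delta X Z Y + delta X Y (A Z) - delta X Z (A Y).
  rewrite /cov_form !nablaE /fundamental_form fieldD -!gDE.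
  rewrite (linearD A) !(formE apc_bilinear).
  rewrite (apc_sym Y (D _)) (apc_sym (A Y) (D _)).
  rewrite (apc_endo_skew (D _)).
  by apply: smooth_ext => p; pointwise; ring.
have FT : F (torsion nabla X Y) Z = - g (torsion nabla X Y) (A Z).
  exact: apc_endo_skew.
rewrite hLC.2 add0r dFcond FT !TE /delta.
rewrite (dF_swap23 X Y Z) (dF_swap23 X (A Y) Z) (dF_swap23 X Y (A Z)).
rewrite (dF_swap23 X (A Y) (A Z)) (dF_swap23 (A X) Y Z).
rewrite (dF_swap23 (A X) (A Y) Z).
by apply: smooth_ext => p; pointwise; lra.
Qed.

End Existence.

End AlmostParacontact.

Theorem theorem3p11 (R : realType) (n : nat) (M : manifold R n.*2.+1)
  (S : almost_paracontact_metric M) (nablag : connection M)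
  (hLC : is_levi_civita (apc_metric S) nablag) :
  let g := apc_metric S in
  let A := apc_endo S in
  let F := fundamental_form S in
  let G := fun X Y => g X Y + F X Y in
  let dF := ext_deriv F in
  let admissible := fun nabla : connection M =>
    einstein_metricity G nabla /\ has_skew_torsion g nabla in
  ((exists nabla : connection M, admissible nabla) <->
   (forall X Y Z : vector_field M,
      cov_form nablag F X Y Z = g (cov_endo nablag A X Y) Z /\
      g (cov_endo nablag A X Y) Z =
        3^-1 *: dF X Y Z + 3^-1 *: dF X (A Y) (A Z)
        - 6^-1 *: dF (A X) Y (A Z) - 6^-1 *: dF (A X) (A Y) Z)) /\
  (forall nabla : connection M, admissible nabla ->
   forall X Y Z : vector_field M,
   [/\ g (torsion nabla X Y) Z = - (3^-1 *: dF X Y Z),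
       g (nabla X Y) Z = g (nablag X Y) Z - 6^-1 *: dF X Y Z
         - 6^-1 *: dF X (A Y) Z + 6^-1 *: dF (A X) Y Z,
       cov_form nabla g X Y Z = - (6^-1 *: (dF X Y (A Z) - dF X (A Y) Z))
     & cov_form nabla F X Y Z =
         6^-1 *: (2 *: dF X Y Z - dF X Y (A Z) - dF X (A Y) Z)]) /\
  (forall nabla1 nabla2 : connection M, admissible nabla1 ->
   admissible nabla2 -> forall X Y, nabla1 X Y = nabla2 X Y).
Proof.
move=> g A F G dF admissible.
have formula nabla : admissible nabla -> forall X Y Z,
    g (nabla X Y) Z = g (nablag X Y) Z - 6^-1 *: dF X Y Z
      - 6^-1 *: dF X (A Y) Z + 6^-1 *: dF (A X) Y Z.
  move=> [E T] X Y Z; rewrite -[LHS](subrK (g (nablag X Y) Z)).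
  by rewrite (einstein_connection hLC T E) addrC !addrA.
split; [split|split].
- move=> [nabla [E T] ] X Y Z; have FA := cov_form_fundamental X Y Z hLC.2.
  by split=> //; rewrite -[LHS]FA (einstein_cov_levi_civita hLC T E).
- move=> cond; apply: (einstein_connection_exists hLC) => X Y Z.
  by have [-> ->] := cond X Y Z.
- move=> nabla adm X Y Z; have [E T] := adm; split.
  + exact: einstein_torsion T E _ _ _.
  + exact: formula.
  + exact: einstein_cov_metric_ext T E _ _ _.
  + exact: einstein_cov_fundamental_ext T E _ _ _.
- move=> nabla1 nabla2 adm1 adm2 X Y; apply: apc_metric_inj => Z.
  exact: etrans (formula _ adm1 X Y Z) (esym (formula _ adm2 X Y Z)).
Qed.
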